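(* Let $\mathbb{N}=\{0,1,2,\dots\}$ and let $P(x_1,\dots,x_n)$ be a homogeneous polynomial with integer coefficients. The following are equivalent: (i) $P(x_1,\dots,x_n)$ is partition regular, i.e. the equation $P(x_1,\dots,x_n)=0$ is partition regular; (ii) for every piecewise syndetic set $A$ in $(\mathbb{N},\cdot)$ there exist $a_1,\dots,a_n\in A$ such that $P(a_1,\dots,a_n)=0$.
   Context: The equation $P(x_1,\dots,x_n)=0$ is partition regular if for every finite partition $\mathbb{N}=A_1\cup\dots\cup A_m$ there are an index $i\leq m$ and elements $a_1,\dots,a_n\in A_i\setminus\{0\}$ such that $P(a_1,\dots,a_n)=0$. A set $A\subseteq\mathbb{N}$ is piecewise syndetic in $(\mathbb{N},\cdot)$ if there is a finite nonempty $G\subseteq\mathbb{N}$ such that for every finite $F\subseteq\mathbb{N}$ there is $x\in\mathbb{N}$ with $F\cdot x\subseteq\bigcup_{t\in G}\{m\in\mathbb{N}\mid tm\in A\}$.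
   Formalization: In the definition of piecewise syndetic, F ranges over finite sets of nonzero naturals; if F may contain 0, a set is piecewise syndetic exactly when it contains 0, and the equivalence fails for x_1 + x_2. *)

(* Defs.v *)
From mathcomp Require Import all_boot all_order all_algebra.
From mathcomp Require Import boolp classical_sets functions cardinality.
From mathcomp Require Export mpoly.

Set Implicit Arguments.
Unset Strict Implicit.
Unset Printing Implicit Defensive.

Import GRing.Theory.
Local Open Scope classical_set_scope.

Definition is_solution (n : nat) (P : {mpoly int[n]}) (a : 'I_n -> nat) : Prop :=
  P.@[fun j => Posz (a j)] = 0%R.

Definition partition_regular (n : nat) (P : {mpoly int[n]}) : Prop :=
  forall (m : nat) (A : 'I_m -> set nat), partition setT A setT ->
    exists (i : 'I_m) (a : 'I_n -> nat),
      (forall j, (A i `\ 0%N) (a j)) /\ is_solution P a.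

(* Here nat contains 0, which is absorbing for multiplication, so the finite
   sets F are taken in nat \ {0}: a set F containing 0 would force 0 \in A, and
   the sets A without 0 could never be piecewise syndetic.  If 0 \notin A, the
   values t = 0 and x = 0 are useless, and the definition amounts to piecewise
   syndeticity in the semigroup of positive integers; if 0 \in A, it always
   holds, with x = 0, as it does when F may contain 0. *)
Definition mul_piecewise_syndetic (A : set nat) : Prop :=
  exists G : set nat, [/\ finite_set G, G !=set0 &
    forall F : set nat, finite_set F -> F `<=` setT `\ 0%N ->
      exists x : nat,
        [set (f * x)%N | f in F] `<=` \bigcup_(t in G) [set m | A (t * m)%N]].

(* Main.v *)
Require Import Defs.
From mathcomp Require Import all_boot all_order all_algebra.
From mathcomp Require Import boolp classical_sets functions cardinality filter.
From mathcomp Require Import mpoly.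

(** Dilation preserves solutions of a homogeneous equation.  If [A] is piecewise
    syndetic through [G], coloring [f <= N] by some [t] in [G] with [t f x] in [A]
    gives finite colorings of arbitrarily long initial segments; a limit of these
    colorings along an ultrafilter has a monochromatic solution, and a dilate of
    it lies in [A].  Conversely, if a thick set is covered by finitely many sets,
    one of them is piecewise syndetic, which applies to the cells of a partition
    of the positive integers. *)

Set Implicit Arguments.
Unset Strict Implicit.
Unset Printing Implicit Defensive.

Local Open Scope classical_set_scope.

Lemma meval_homogZ (n d : nat) (R : comNzRingType) (p : {mpoly R[n]})
    (v : 'I_n -> R) (c : R) :
  p \is @ishomog1 n R d mdeg ->
  p.@[fun j => c * v j]%R = (c ^+ d * p.@[v])%R.
Proof.
move=> /dhomogP hp; rewrite !mevalE GRing.mulr_sumr !big_seq.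
apply: eq_bigr => m /hp /= <-; rewrite mdegE -GRing.prodrXr GRing.mulrCA.
rewrite -big_split /=; congr (_ * _)%R.
by apply: eq_bigr => i _; rewrite GRing.exprMn.
Qed.

Lemma is_solution_dilate (n d : nat) (P : {mpoly int[n]}) (a : 'I_n -> nat)
    (k : nat) :
  P \is @ishomog1 n int d mdeg -> is_solution P a ->
  is_solution P (fun j => k * a j)%N.
Proof.
move=> hP; rewrite /is_solution => Pa.
have -> : (fun j => Posz (k * a j)) = (fun j => Posz k * Posz (a j))%R by [].
by rewrite (meval_homogZ _ _ hP) Pa GRing.mulr0.
Qed.

(* The partitions of [partition_regular] have nonempty cells, so only the colors
   in the range of [chi] are used. *)
Lemma partition_regular_coloring (n : nat) (P : {mpoly int[n]}) (C : finType)
    (chi : nat -> C) :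
  partition_regular P ->
  exists (t : C) (a : 'I_n -> nat),
    (forall j, 0 < a j /\ chi (a j) = t) /\ is_solution P a.
Proof.
move=> prP; pose S := [set t : C | `[< range chi t >]]%SET.
have inS x : chi x \in S by rewrite inE; apply/asboolP; exists x.
pose A (i : 'I_#|S|) := [set x | chi x = enum_val i].
have [|i [a [aA Pa]]] := prP #|S| A.
  split.
  - rewrite coverE -subTset => x _.
    by exists (enum_rank_in (inS x) (chi x)); rewrite //= /A /= enum_rankK_in.
  - by move=> i j _ _ [x []]; rewrite /A /= => -> /enum_val_inj.
  - by move=> i _; have := enum_valP i; rewrite inE => /asboolP [x _ xi]; exists x.
exists (enum_val i), a; split=> // j; have [aij /eqP] := aA j.
by rewrite -lt0n; split.
Qed.

(** If no fibre of [f] were in [U], all their complements would be, and so would the finite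
    intersection of these, which is empty. *)
Lemma ultra_pigeonhole (T : Type) (U : set_system T) (C : finType) (f : T -> C) :
  UltraFilter U -> exists t, U [set x | f x = t].
Proof.
move=> UU; apply: contrapT => /forallNP nU.
have UF : ProperFilter U by exact: ultra_proper.
have /filter_forall H t : U (~` [set x | f x = t]).
  by have [/nU|] := in_ultra_setVsetC [set x | f x = t] UU.
by have [x /(_ (f x)) /=] := filter_ex H.
Qed.

(** For a nonprincipal ultrafilter [U], [chi x] is the value of [c M x] for [U]-almost all [M].
    Finitely many such conditions hold together for arbitrarily large [M]. *)
Lemma coloring_compactness (C : finType) (c : nat -> nat -> C) :
  exists chi : nat -> C, forall (N : nat) (I : finType) (a : I -> nat),
    exists M, N <= M /\ forall i, c M (a i) = chi (a i).
Proof.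
have [U [UU ooU]] := ultraFilterLemma eventually_filter.
have UF : ProperFilter U by exact: ultra_proper.
have /choice [chi chiP] x := ultra_pigeonhole (fun M => c M x) UU.
exists chi => N I a.
have UN : U [set M | N <= M] by apply: ooU; exists N.
have UI : U [set M | forall i, c M (a i) = chi (a i)].
  by apply: filter_forall => i; apply: chiP.
by have [M [NM Ma]] := filter_ex (filterI UN UI); exists M.
Qed.

(* If [T `\` A i] is not thick, as witnessed by a finite set [F0], then [A i] is
   piecewise syndetic with [G = F0]. *)
Lemma thick_cover_piecewise_syndetic (I : eqType) (A : I -> set nat) (s : seq I)
    (T : set nat) :
  (forall F : set nat, finite_set F -> F `<=` setT `\ 0%N ->
     exists x, forall f, F f -> T (f * x)%N) ->
  (forall x, T x -> exists2 i, i \in s & A i x) ->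
  exists2 i, i \in s & mul_piecewise_syndetic (A i).
Proof.
elim: s T => [|i s IHs] T thickT coverT.
  have [||x Tx] := thickT [set 1%N]; first exact: finite_set1.
    by move=> f ->.
  by have [] := coverT _ (Tx 1%N erefl).
have [thickTi|] := pselect (forall F : set nat, finite_set F ->
    F `<=` setT `\ 0%N -> exists x, forall f, F f -> (T `\` A i) (f * x)%N).
  have [x [Tx nAx]|j js pwsj] := IHs (T `\` A i) thickTi.
    by have [j] := coverT x Tx; rewrite inE => /predU1P [-> //|js Ajx]; exists j.
  by exists j => //; rewrite inE js orbT.
move=> /existsNP [F0 /not_implyP [finF0 /not_implyP [F0pos /forallNP nF0]]].
have nF0' x : exists2 f, F0 f & T (f * x)%N -> A i (f * x)%N.
  have /existsNP [f /not_implyP [F0f nTA]] := nF0 x.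
  by exists f => // Tf; apply: contrapT => nAf; apply: nTA.
exists i; first exact: mem_head.
exists F0; split=> //; first by have [f F0f _] := nF0' 0%N; exists f.
move=> F finF Fpos.
(* Thickness for the product set puts every [f * g * x] in [T]; for each [g], [nF0'] at [g * x] then
   selects an [f] landing in [A i]. *)
have [||x Tx] := thickT [set (f * g)%N | f in F0 & g in F].
- exact: finite_image2.
- move=> _ [f /F0pos [_ /eqP f0]] [g /Fpos [_ /eqP g0]] <-.
  by split=> //; apply/eqP; rewrite muln_eq0 negb_or f0.
exists x => _ [g Fg <-]; have [f F0f fA] := nF0' (g * x)%N.
exists f => //=; apply: fA; rewrite mulnA; apply: Tx.
by exists f => //; exists g.
Qed.

Lemma piecewise_syndetic_solution (n d : nat) (P : {mpoly int[n]}) (A : set nat) :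
  P \is @ishomog1 n int d mdeg -> partition_regular P ->
  mul_piecewise_syndetic A ->
  exists a : 'I_n -> nat, (forall j, A (a j)) /\ is_solution P a.
Proof.
move=> hP prP [G [/finite_seqP [s ->] [t0 /= t0s] pwsA]].
have /choice [x xP] (M : nat) : exists x, forall f, 0 < f <= M ->
    exists t : seq_sub s, A (val t * (f * x))%N.
  have [||x xM] := pwsA [set f | 0 < f <= M].
  - apply: sub_finite_set (finite_II M.+1) => f /= /andP [_]; exact.
  - by move=> f /= /andP [f0 _]; split=> // f0'; rewrite f0' in f0.
  exists x => f fM.
  by have [|t ts At] := xM (f * x)%N; [exists f | exists (SeqSub ts)].
(* Outside the range [0 < f <= M] the color is arbitrary, and [t0] only provides some value. *)
have /choice [c cP] (Mf : nat * nat) : exists t : seq_sub s,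
    0 < Mf.2 <= Mf.1 -> A (val t * (Mf.2 * x Mf.1))%N.
  have [/xP [t At]|nM] := boolP (0 < Mf.2 <= Mf.1); first by exists t.
  by exists (SeqSub t0s).
have [chi chiP] := coloring_compactness (fun M f => c (M, f)).
have [t [a [at_ Pa]]] := partition_regular_coloring chi prP.
(* Taking [M] at least every [a j] makes each color [c (M, a j)] meaningful; all equal [t], so one
   factor [val t * x M] sends every [a j] into [A]. *)
have [M [NM Ma]] := chiP (\max_j a j) _ a.
exists (fun j => val t * x M * a j)%N; split; last exact: is_solution_dilate hP Pa.
move=> j; have [aj0 <-] := at_ j.
rewrite -mulnA (mulnC (x M)) -Ma; apply: (cP (M, a j)) => /=.
by rewrite aj0 (leq_trans (leq_bigmax j)).
Qed.

Theorem corollary6p14 (n d : nat) (P : {mpoly int[n]})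
    (hP : P \is @ishomog1 n int d mdeg) :
  partition_regular P <->
  (forall A : set nat, mul_piecewise_syndetic A ->
     exists a : 'I_n -> nat, (forall j : 'I_n, A (a j)) /\ is_solution P a).
Proof.
split=> [prP A|solP m A [covA _ _]]; first exact: piecewise_syndetic_solution hP prP.
(* Removing [0] from the cells forces the solution to have nonzero entries. *)
have [||i _ /solP [a [aA Pa]]] := @thick_cover_piecewise_syndetic _
    (fun i => A i `\ 0%N) (enum 'I_m) (setT `\ 0%N); last by exists i, a.
- by move=> F _ Fpos; exists 1%N => f; rewrite muln1; apply: Fpos.
- move=> x [_ x0]; have : [set: nat] x by [].
  by rewrite -covA => -[i _ Aix]; exists i; rewrite ?mem_enum.
Qed.
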